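(* Let $k\geq 2$ be an integer. For any graph $G$ of order $n$ with minimum degree $\delta(G)\geq k-1$, \[ 2k\leq \gamma_{\times kR}(G)\leq 2n, \] and $\gamma_{\times kR}(G)=2k$ if and only if $G=K_k$ or $G=H\circ_k K_k$ for some graph $H$ (equality of graphs meaning isomorphism).
   Context: All graphs are finite, undirected and simple; the order of a graph is its number of vertices. For an integer $k\geq 1$ and a graph $G=(V,E)$ with minimum degree at least $k-1$, a Roman $k$-tuple dominating function (R$k$DF) on $G$ is a function $f\colon V\to\{0,1,2\}$ such that every vertex $v$ with $f(v)=0$ has at least $k$ neighbors $w$ with $f(w)=2$, and every vertex $v$ with $f(v)\neq 0$ has at least $k-1$ neighbors $w$ with $f(w)=2$. The weight of $f$ is $f(V)=\sum_{v\in V}f(v)$, and the Roman $k$-tuple domination number $\gamma_{\times kR}(G)$ is the minimum weight of an R$k$DF on $G$. $K_k$ is the complete graph of order $k$. For an integer $k\geq 1$, a $k$-join $G\circ_k H$ of a graph $G$ to a graph $H$ of order at least $k$ is a graph obtained from the disjoint union of $G$ and $H$ by joining each vertex of $G$ to at least $k$ vertices of $H$. *)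

(* Defs.v *)
From mathcomp Require Import all_boot.

Set Implicit Arguments.
Unset Strict Implicit.
Unset Printing Implicit Defensive.

Record sgraph := SGraph {
  vertex :> finType;
  adj : rel vertex;
  adj_sym : symmetric adj;
  adj_irrefl : irreflexive adj }.

Definition isomorphic (G H : sgraph) : Prop :=
  exists2 phi : G -> H,
    bijective phi & forall x y : G, adj (phi x) (phi y) = adj x y.

Definition degree (G : sgraph) (v : G) : nat := #|[set w | adj v w]|.

(* Every degree is smaller than the order, so on a graph with at least one
   vertex the default value of the iterated minimum plays no role. *)
Definition min_degree (G : sgraph) : nat :=
  \big[minn/#|G|]_(v : G) degree v.

Lemma min_degree_le (G : sgraph) (v : G) : min_degree G <= degree v.
Proof.
rewrite /min_degree; elim: (index_enum G) (mem_index_enum v) => // x r IHr.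
rewrite inE big_cons geq_min => /predU1P[-> | /IHr ->].
  by rewrite leqnn.
by rewrite orbT.
Qed.

Section CompleteGraph.
Variable k : nat.
Definition complete_adj : rel 'I_k := fun x y => x != y.
Lemma complete_adj_sym : symmetric complete_adj.
Proof. by move=> x y; rewrite /complete_adj eq_sym. Qed.
Lemma complete_adj_irrefl : irreflexive complete_adj.
Proof. by move=> x; rewrite /complete_adj eqxx. Qed.
Definition complete : sgraph := SGraph complete_adj_sym complete_adj_irrefl.
End CompleteGraph.

Section JoinBy.
Variables (G H : sgraph) (c : G -> H -> bool).
Definition join_adj : rel (G + H)%type := fun a b =>
  match a, b with
  | inl x, inl x' => adj x x'
  | inr y, inr y' => adj y y'
  | inl x, inr y => c x y
  | inr y, inl x => c x y
  end.
Lemma join_adj_sym : symmetric join_adj.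
Proof. by move=> [x|y] [x'|y'] //=; rewrite adj_sym. Qed.
Lemma join_adj_irrefl : irreflexive join_adj.
Proof. by move=> [x|y] /=; rewrite adj_irrefl. Qed.
Definition join_by : sgraph := SGraph join_adj_sym join_adj_irrefl.
End JoinBy.

(* A k-join depends on the choice [c] of the added edges, so "J is a k-join of
   G to H" is a predicate on J. *)
Definition is_kjoin (k : nat) (G H J : sgraph) : Prop :=
  k <= #|H| /\
  exists2 c : G -> H -> bool,
    forall x : G, k <= #|[set y | c x y]| & isomorphic J (join_by c).

Section RomanTuple.
Variables (k : nat) (G : sgraph).
Implicit Type f : {ffun G -> 'I_3}.

Definition two_neighbors f (v : G) : {set G} :=
  [set w | adj v w & f w == 2 :> nat].

Definition RkDF f : bool :=
  [forall v : G, if f v == 0 :> nat then k <= #|two_neighbors f v|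
                 else k - 1 <= #|two_neighbors f v|].

Definition weight f : nat := \sum_(v : G) f v.

Lemma RkDF_weight_exists :
  k - 1 <= min_degree G -> exists m, [exists f, RkDF f && (weight f == m)].
Proof.
move=> hdeg; pose f2 : {ffun G -> 'I_3} := [ffun=> ord_max].
exists (weight f2); apply/existsP; exists f2; rewrite eqxx andbT.
apply/forallP => v; rewrite ffunE /=; apply: leq_trans hdeg _.
have -> : #|two_neighbors f2 v| = degree v.
  by apply: eq_card => w; rewrite !inE ffunE andbT.
exact: min_degree_le.
Qed.

Definition roman_number (hdeg : k - 1 <= min_degree G) : nat :=
  ex_minn (RkDF_weight_exists hdeg).
End RomanTuple.

(* Main.v *)
(** A vertex of value 2 exists (every vertex has a neighbor of value 2, since
    k >= 2) and has k - 1 neighbors of value 2, so at least k vertices have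
    value 2 and the weight is at least 2k.  Weight 2k forces exactly k such
    vertices and no vertex of value 1, so the vertices of value 2 are adjacent
    to every other vertex.  Conversely K_k and the k-joins to K_k are exactly
    the graphs with k such universal vertices, because each vertex of H must be
    joined to all of K_k. *)

Require Import Defs.
From mathcomp Require Import all_boot.

Set Implicit Arguments.
Unset Strict Implicit.
Unset Printing Implicit Defensive.

(** Since [y] is not confined to [S], such a set is a clique that is also completely joined to its
    complement. *)
Definition universal (G : sgraph) (S : {set G}) : Prop :=
  forall x y : G, x \in S -> x != y -> adj x y.

Definition value_set (G : sgraph) (f : {ffun G -> 'I_3}) (i : nat) : {set G} :=
  [set v | f v == i :> nat].

Lemma isomorphic_sym (G H : sgraph) : isomorphic G H -> isomorphic H G.
Proof.
move=> [phi [psi phiK psiK] adj_phi].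
by exists psi => [|x y]; [exists phi | rewrite -adj_phi !psiK].
Qed.

Lemma weightE (G : sgraph) (f : {ffun G -> 'I_3}) :
  weight f = 2 * #|value_set f 2| + #|value_set f 1|.
Proof.
have cardE i : #|value_set f i| = \sum_(v : G) (f v == i :> nat).
  rewrite -sum1_card big_mkcond; apply: eq_bigr => v _.
  by rewrite inE; case: eqP.
rewrite !cardE big_distrr -big_split; apply: eq_bigr => v _ /=.
by case: (f v) => [[|[|[|]]]].
Qed.

Lemma two_neighborsE (G : sgraph) (f : {ffun G -> 'I_3}) (v : G) :
  two_neighbors f v = [set w | adj v w] :&: value_set f 2.
Proof. by apply/setP => w; rewrite !inE. Qed.

(** Adjacency is irreflexive, so [v] itself drops out; this loss of one matches the threshold
    [k - 1] at a vertex of value 2. *)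
Lemma two_neighbors_subD1 (G : sgraph) (f : {ffun G -> 'I_3}) (v : G) :
  two_neighbors f v \subset value_set f 2 :\ v.
Proof.
apply/subsetP => w; rewrite !inE => /andP[vw ->]; rewrite andbT.
by apply: contraTneq vw => ->; rewrite adj_irrefl.
Qed.

Lemma RkDF_card_value2 (k : nat) (G : sgraph) (f : {ffun G -> 'I_3}) :
  2 <= k -> 0 < #|G| -> RkDF k f -> k <= #|value_set f 2|.
Proof.
move=> k2 /card_gt0P[v _] /forallP fP.
have [w] : exists w, w \in value_set f 2.
  have : 0 < #|two_neighbors f v|.
    (* Both thresholds, [k] and [k - 1], are positive because [2 <= k]. *)
    by have := fP v; case: ifP => _; apply: leq_trans; rewrite ?subn_gt0 // ltnW.
  by case/card_gt0P=> w; rewrite inE => /andP[_ fw]; exists w; rewrite inE.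
rewrite (cardsD1 w) => fw; rewrite fw -leq_subLR.
have := fP w; move: fw; rewrite inE => /eqP -> /= /leq_trans; apply.
exact/subset_leq_card/two_neighbors_subD1.
Qed.

(** The neighbors of [y] of value 2 lie in [value_set f 2 :\ y], and the threshold at [y] equals the
    size of that set, so [y] is adjacent to all of it. *)
Lemma RkDF_universal (k : nat) (G : sgraph) (f : {ffun G -> 'I_3}) :
  RkDF k f -> #|value_set f 2| = k -> #|value_set f 1| = 0 ->
  universal (value_set f 2).
Proof.
move=> /forallP fP card2 /cards0_eq f1 x y fx xy; rewrite adj_sym.
suff : x \in two_neighbors f y by rewrite inE => /andP[].
have subD1 := two_neighbors_subD1 f y.
have {fP} fy := fP y; have [f2y | f2y] := boolP (y \in value_set f 2).
  suff -> : two_neighbors f y = value_set f 2 :\ y by rewrite in_setD1 xy.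
  apply/eqP; rewrite eqEcard subD1 /=.
  move: card2 fy; rewrite (cardsD1 y) f2y => <-.
  by move: f2y; rewrite inE => /eqP ->; rewrite addKn.
suff -> : two_neighbors f y = value_set f 2 by [].
apply/eqP; rewrite eqEcard (subset_trans subD1 (subsetDl _ _)) card2 /=.
(* Value 1 is excluded by [f1], so [y] has value 0 and its threshold is [k] rather than [k - 1]. *)
move: fy f2y; have := in_set0 y; rewrite -f1 !inE.
by case: (f y) => [[|[|[|]]]].
Qed.

(** Take value 2 on [S] and 0 elsewhere: every [v] is adjacent to all of [S :\ v], which has [k - 1]
    elements if [v] is in [S] and [k] otherwise. *)
Lemma universal_RkDF (k : nat) (G : sgraph) (S : {set G}) :
  #|S| = k -> universal S ->
  exists2 f : {ffun G -> 'I_3}, RkDF k f & weight f = 2 * k.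
Proof.
move=> cardS univS.
pose f : {ffun G -> 'I_3} := [ffun v => if v \in S then ord_max else ord0].
have f2 : value_set f 2 = S.
  by apply/setP => v; rewrite inE ffunE; case: (v \in S).
have f1 : value_set f 1 = set0.
  by apply/setP => v; rewrite !inE ffunE; case: (v \in S).
exists f; last by rewrite weightE f2 f1 cards0 addn0 cardS.
apply/forallP => v.
have sub : S :\ v \subset two_neighbors f v.
  rewrite two_neighborsE f2; apply/subsetP => w; rewrite !inE => /andP[wv wS].
  by rewrite wS andbT adj_sym univS.
move: (subset_leq_card sub) (cardsD1 v S); rewrite cardS ffunE.
by case: (v \in S) => /= le ->; rewrite ?addKn.
Qed.

Section Induced.
Variables (G : sgraph) (P : pred G).
Definition induced_adj : rel {x : G | P x} := fun x y => adj (val x) (val y).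
Lemma induced_adj_sym : symmetric induced_adj.
Proof. by move=> x y; apply: adj_sym. Qed.
Lemma induced_adj_irrefl : irreflexive induced_adj.
Proof. by move=> x; apply: adj_irrefl. Qed.
Definition induced : sgraph := SGraph induced_adj_sym induced_adj_irrefl.
End Induced.

(** Enumerating the clique [S] gives a copy of $K_k$; the vertices outside [S], if there are any,
    induce the graph [H]. *)
Lemma universal_complete_or_kjoin (k : nat) (G : sgraph) (S : {set G}) :
  #|S| = k -> universal S ->
  isomorphic G (complete k) \/
  exists H : sgraph, 0 < #|H| /\ is_kjoin k H (complete k) G.
Proof.
move=> cardS univS.
pose e (i : complete k) : G := enum_val (cast_ord (esym cardS) i).
have eS i : e i \in S by apply: enum_valP.
have e_inj : injective e by move=> i j /enum_val_inj /cast_ord_inj.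
have adj_e i j : adj (e i) (e j) = (i != j).
  have [-> | ij] := eqVneq i j; first by rewrite adj_irrefl.
  by apply: univS => //; rewrite (inj_eq e_inj).
have [/eqP | ] := posnP #|~: S|.
  rewrite cards_eq0 => /eqP S0; left; apply: isomorphic_sym; exists e => //.
  apply: inj_card_bij => //.
  by rewrite card_ord -cardS -[S]setCK S0 setC0 cardsT.
move=> H0; right; pose H := induced (fun x : G => x \in ~: S); exists H.
have cardH : #|H| = #|~: S| by rewrite card_sig; apply: eq_card.
split; first by rewrite cardH.
split; first by rewrite card_ord.
(* Universality of [S] puts every cross edge in [G]. *)
exists (fun _ _ => true) => [x|].
  rewrite (eq_card (B := 'I_k)) ?card_ord // => y; exact: in_set.
apply: isomorphic_sym.
pose psi (u : H + complete k) : G :=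
  match u with inl x => val x | inr i => e i end.
exists psi.
  apply: inj_card_bij => [[x|i] [y|j] //=|].
  - by move/val_inj->.
  - by move=> xj; have := valP x; rewrite inE /= xj eS.
  - by move=> iy; have := valP y; rewrite inE /= -iy eS.
  - by move/e_inj->.
  - by rewrite /= card_sum cardH card_ord -cardS addnC cardsC.
have neq (x : H) i : e i != val x.
  by apply: contraTneq (valP x) => <-; rewrite inE eS.
move=> [x|i] [y|j] //=.
- by rewrite adj_sym univS ?neq ?eS.
- by rewrite univS ?neq ?eS.
Qed.

Lemma complete_or_kjoin_universal (k : nat) (G : sgraph) :
  isomorphic G (complete k) \/
  (exists H : sgraph, 0 < #|H| /\ is_kjoin k H (complete k) G) ->
  exists2 S : {set G}, #|S| = k & universal S.
Proof.
case=> [[phi phi_bij adj_phi] | [H [_ [_ [c c_ge [phi phi_bij adj_phi]]]]]].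
  exists setT => [|x y _ xy]; first by rewrite cardsT (bij_eq_card phi_bij) card_ord.
  by rewrite -adj_phi /= /complete_adj (inj_eq (bij_inj phi_bij)).
pose K : {set join_by c} := [set inr i | i : complete k].
(* At least [k] of the [k] vertices of $K_k$ means all of them. *)
have c_all x i : c x i.
  have : i \in [set y | c x y].
    suff -> : [set y | c x y] = setT by rewrite inE.
    by apply/eqP; rewrite eqEcard subsetT cardsT card_ord c_ge.
  by rewrite inE.
(* The copy of $K_k$ in the join is pulled back to [G]. *)
exists (phi @^-1: K) => [|x y].
  rewrite on_card_preimset; last exact: onW_bij.
  by rewrite card_imset ?cardsT ?card_ord // => i j [].
rewrite inE -adj_phi => /imsetP[i _ phix] xy.
have : phi x != phi y by rewrite (inj_eq (bij_inj phi_bij)).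
by rewrite phix; case: (phi y) => [z _|j] //=; apply: c_all.
Qed.

Theorem theorem1 (k : nat) (hk : 2 <= k) (G : sgraph) (n : nat)
    (hn : #|G| = n) (hn0 : 0 < n) (hdeg : k - 1 <= min_degree G) :
  2 * k <= roman_number hdeg <= 2 * n /\
  (roman_number hdeg = 2 * k <->
   isomorphic G (complete k) \/
   exists H : sgraph, 0 < #|H| /\ is_kjoin k H (complete k) G).
Proof.
rewrite /roman_number; case: ex_minnP => m /existsP[f /andP[fP /eqP wf]] min_m.
have G0 : 0 < #|G| by rewrite hn.
have k_le := RkDF_card_value2 hk G0 fP.
have m_ge : 2 * k <= m.
  by rewrite -wf weightE (leq_trans _ (leq_addr _ _)) // leq_mul2l.
split.
  (* Values in ['I_3] are at most 2, so the minimizer [f] is compared termwise with the constant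
     2. *)
  rewrite m_ge /= -hn -wf mulnC -sum_nat_const; apply: leq_sum => v _.
  by rewrite -ltnS ltn_ord.
split=> [mk | /complete_or_kjoin_universal[S cardS univS]].
  have := wf; rewrite mk weightE => wE.
  (* In $2k = 2|V_2| + |V_1|$ the bound $|V_2| \geq k$ forces $|V_2| = k$, and then $V_1$ is
     empty. *)
  have card2 : #|value_set f 2| = k.
    apply/eqP; rewrite eqn_leq k_le andbT -(leq_pmul2l (isT : 0 < 2)) -wE.
    exact: leq_addr.
  apply: (@universal_complete_or_kjoin _ _ (value_set f 2) card2).
  apply: (RkDF_universal fP card2); apply/eqP.
  by rewrite -(eqn_add2l (2 * k)) addn0 -{1}card2 wE.
apply/eqP; rewrite eqn_leq m_ge andbT.
have [g gP wg] := universal_RkDF cardS univS.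
by apply: min_m; apply/existsP; exists g; rewrite gP wg eqxx.
Qed.
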